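(* Let $J\colon\mathcal A\to\mathcal E$ be a pseudofunctor between bicategories and let $T$ be a $J$-relative pseudomonad. The $T$-pseudoalgebras, lax morphisms between them, and transformations between lax morphisms form a bicategory $\mathrm{PsAlg}_l(T)$.
   Context: Conventions. For a bicategory $\mathcal E$, $\mathcal E[X,Y]$ is the hom-category; composition of 1-cells and whiskering are written by juxtaposition, vertical composition of 2-cells by $\circ$; structural isomorphisms (associators, unitors, pseudofunctor constraints) are left implicit in equations or written $\cong$. A $J$-relative pseudomonad $T$ comprises: an object $TX\in\mathcal E$ for each $X\in\mathcal A$; functors $(-)^*\colon\mathcal E[JX,TY]\to\mathcal E[TX,TY]$ for $X,Y\in\mathcal A$; 1-cells $i_X\colon JX\to TX$; invertible 2-cells $\mu_{g,f}\colon(g^*f)^*\Rightarrow g^*f^*$ natural in $f\colon JX\to TY$, $g\colon JY\to TZ$; invertible 2-cells $\eta_f\colon f\Rightarrow f^*i_X$ natural in $f\colon JX\to TY$; invertible 2-cells $\theta_X\colon(i_X)^*\Rightarrow 1_{TX}$; such that $(\mu_{h,g}f^* )\circ\mu_{h^*g,f}=(h^*\mu_{g,f})\circ\mu_{h,g^*f}\circ(\mu_{h,g}f)^*$ for all $f\colon JW\to TX$, $g\colon JX\to TY$, $h\colon JY\to TZ$, and $(f^*\theta_X)\circ\mu_{f,i_X}\circ(\eta_f)^*$ is the structural isomorphism $f^*\cong f^*1_{TX}$ for all $f\colon JX\to TY$. A $T$-pseudoalgebra $(A,(-)^a,\hat a,\tilde a)$ comprises: an object $A\in\mathcal E$; functors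 $(-)^a\colon\mathcal E[JX,A]\to\mathcal E[TX,A]$ for $X\in\mathcal A$; invertible 2-cells $\hat a_{g,f}\colon(g^af)^a\Rightarrow g^af^*$ natural in $f\colon JX\to TY$, $g\colon JY\to A$; invertible 2-cells $\tilde a_f\colon f\Rightarrow f^ai_X$ natural in $f\colon JX\to A$; such that $(\hat a_{h,g}f^* )\circ\hat a_{h^ag,f}=(h^a\mu_{g,f})\circ\hat a_{h,g^*f}\circ(\hat a_{h,g}f)^a$ for all $f\colon JX\to TY$, $g\colon JY\to TZ$, $h\colon JZ\to A$, and $(f^a\theta_X)\circ\hat a_{f,i_X}\circ(\tilde a_f)^a$ is the structural isomorphism $f^a\cong f^a1_{TX}$ for all $f\colon JX\to A$. A lax morphism $(h,\overline h)\colon(A,(-)^a,\hat a,\tilde a)\to(B,(-)^b,\hat b,\tilde b)$ comprises a 1-cell $h\colon A\to B$ and 2-cells $\overline h_f\colon(hf)^b\Rightarrow hf^a$ natural in $f\colon JX\to A$ such that $(h\hat a_{g,f})\circ\overline h_{g^af}\circ(\overline h_gf)^b=(\overline h_gf^* )\circ\hat b_{hg,f}$ for all $f\colon JX\to TY$, $g\colon JY\to A$, and $(\overline h_fi_X)\circ\tilde b_{hf}=h\tilde a_f$ for all $f\colon JX\to A$. A transformation $(h,\overline h)\Rightarrow(h',\overline{h'})$ is a 2-cell $\alpha\colon h\Rightarrow h'$ such that $\overline{h'}_f\circ(\alpha f)^b=(\alpha f^a)\circ\overline h_f$ for all $f\colon JX\to A$. The structure of $\mathrm{PsAlg}_l(T)$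 is as follows. The identity on $A$ is $1_A$ equipped with $(1_Af)^a\cong f^a\cong 1_Af^a$. The composite of $(h,\overline h)\colon A\to B$ and $(h',\overline{h'})\colon B\to C$ is $h'h$ equipped with $((h'h)f)^c\cong(h'(hf))^c\xrightarrow{\overline{h'}_{hf}}h'(hf)^b\xrightarrow{h'\overline h_f}h'(hf^a)\cong(h'h)f^a$. Vertical and horizontal composition of transformations, associators and unitors are those of $\mathcal E$. *)

(* Defs.v *)
Set Implicit Arguments.
Unset Strict Implicit.
Unset Printing Implicit Defensive.

Declare Scope bicat_scope.
Delimit Scope bicat_scope with bicat.
Open Scope bicat_scope.

(* [comp g f] is the 1-cell "g after f"; [vcomp b a] is vertical composition
   "b after a"; [hcomp b a] is the action of the composition functor
   E[Y,Z] x E[X,Y] -> E[X,Z] on 2-cells. *)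
Record bicat_data := BicatData {
  Ob :> Type;
  Hom : Ob -> Ob -> Type;
  Cell : forall X Y : Ob, Hom X Y -> Hom X Y -> Type;
  id1 : forall X : Ob, Hom X X;
  comp : forall X Y Z : Ob, Hom Y Z -> Hom X Y -> Hom X Z;
  id2 : forall (X Y : Ob) (f : Hom X Y), Cell f f;
  vcomp : forall (X Y : Ob) (f g h : Hom X Y), Cell g h -> Cell f g -> Cell f h;
  hcomp : forall (X Y Z : Ob) (g g' : Hom Y Z) (f f' : Hom X Y),
    Cell g g' -> Cell f f' -> Cell (comp g f) (comp g' f');
  assoc : forall (W X Y Z : Ob) (h : Hom Y Z) (g : Hom X Y) (f : Hom W X),
    Cell (comp (comp h g) f) (comp h (comp g f));
  assoc_inv : forall (W X Y Z : Ob) (h : Hom Y Z) (g : Hom X Y) (f : Hom W X),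
    Cell (comp h (comp g f)) (comp (comp h g) f);
  lunit : forall (X Y : Ob) (f : Hom X Y), Cell (comp (id1 Y) f) f;
  lunit_inv : forall (X Y : Ob) (f : Hom X Y), Cell f (comp (id1 Y) f);
  runit : forall (X Y : Ob) (f : Hom X Y), Cell (comp f (id1 X)) f;
  runit_inv : forall (X Y : Ob) (f : Hom X Y), Cell f (comp f (id1 X))
}.

Arguments Hom {b} X Y.
Arguments Cell {b X Y} f g.
Arguments id1 {b} X.
Arguments comp {b X Y Z} g f.
Arguments id2 {b X Y} f.
Arguments vcomp {b X Y f g h} _ _.
Arguments hcomp {b X Y Z g g' f f'} _ _.
Arguments assoc {b W X Y Z} h g f.
Arguments assoc_inv {b W X Y Z} h g f.
Arguments lunit {b X Y} f.
Arguments lunit_inv {b X Y} f.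
Arguments runit {b X Y} f.
Arguments runit_inv {b X Y} f.

Notation "g · f" := (comp g f) (at level 40, left associativity) : bicat_scope.
Notation "b ∘ a" := (vcomp b a) (at level 50, left associativity) : bicat_scope.
Notation "b ⋆ a" := (hcomp b a) (at level 40, left associativity) : bicat_scope.
Notation "h ◃ a" := (hcomp (id2 h) a) (at level 40, left associativity) : bicat_scope.
Notation "a ▹ f" := (hcomp a (id2 f)) (at level 40, left associativity) : bicat_scope.

Record is_bicategory (E : bicat_data) : Prop := IsBicategory {
  vcomp_id_l : forall (X Y : E) (f g : Hom X Y) (a : Cell f g), id2 g ∘ a = a;
  vcomp_id_r : forall (X Y : E) (f g : Hom X Y) (a : Cell f g), a ∘ id2 f = a;
  vcomp_assoc : forall (X Y : E) (f g h k : Hom X Y)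
      (c : Cell h k) (b : Cell g h) (a : Cell f g),
    (c ∘ b) ∘ a = c ∘ (b ∘ a);
  hcomp_id : forall (X Y Z : E) (g : Hom Y Z) (f : Hom X Y),
    id2 g ⋆ id2 f = id2 (g · f);
  hcomp_vcomp : forall (X Y Z : E) (g g' g'' : Hom Y Z) (f f' f'' : Hom X Y)
      (b' : Cell g' g'') (b : Cell g g') (a' : Cell f' f'') (a : Cell f f'),
    (b' ∘ b) ⋆ (a' ∘ a) = (b' ⋆ a') ∘ (b ⋆ a);
  assoc_natural : forall (W X Y Z : E) (h h' : Hom Y Z) (g g' : Hom X Y)
      (f f' : Hom W X) (c : Cell h h') (b : Cell g g') (a : Cell f f'),
    assoc h' g' f' ∘ ((c ⋆ b) ⋆ a) = (c ⋆ (b ⋆ a)) ∘ assoc h g f;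
  lunit_natural : forall (X Y : E) (f f' : Hom X Y) (a : Cell f f'),
    lunit f' ∘ (id1 Y ◃ a) = a ∘ lunit f;
  runit_natural : forall (X Y : E) (f f' : Hom X Y) (a : Cell f f'),
    runit f' ∘ (a ▹ id1 X) = a ∘ runit f;
  assoc_inv_l : forall (W X Y Z : E) (h : Hom Y Z) (g : Hom X Y) (f : Hom W X),
    assoc_inv h g f ∘ assoc h g f = id2 ((h · g) · f);
  assoc_inv_r : forall (W X Y Z : E) (h : Hom Y Z) (g : Hom X Y) (f : Hom W X),
    assoc h g f ∘ assoc_inv h g f = id2 (h · (g · f));
  lunit_inv_l : forall (X Y : E) (f : Hom X Y),
    lunit_inv f ∘ lunit f = id2 (id1 Y · f);
  lunit_inv_r : forall (X Y : E) (f : Hom X Y), lunit f ∘ lunit_inv f = id2 f;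
  runit_inv_l : forall (X Y : E) (f : Hom X Y),
    runit_inv f ∘ runit f = id2 (f · id1 X);
  runit_inv_r : forall (X Y : E) (f : Hom X Y), runit f ∘ runit_inv f = id2 f;
  pentagon : forall (V W X Y Z : E) (k : Hom Y Z) (h : Hom X Y) (g : Hom W X)
      (f : Hom V W),
    assoc k h (g · f) ∘ assoc (k · h) g f
    = (k ◃ assoc h g f) ∘ assoc k (h · g) f ∘ (assoc k h g ▹ f);
  triangle : forall (X Y Z : E) (g : Hom Y Z) (f : Hom X Y),
    (g ◃ lunit f) ∘ assoc g (id1 Y) f = runit g ▹ f
}.

Record bicategory := Bicategory {
  bicat_carrier :> bicat_data;
  bicat_laws : is_bicategory bicat_carrier
}.

Definition invertible (E : bicat_data) (X Y : E) (f g : Hom X Y)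
    (a : Cell f g) : Prop :=
  exists b : Cell g f, b ∘ a = id2 f /\ a ∘ b = id2 g.

Record hom_functor (D E : bicat_data) (X Y : D) (X' Y' : E) := HomFunctor {
  hf_ob :> Hom X Y -> Hom X' Y';
  hf_cell : forall f g : Hom X Y, Cell f g -> Cell (hf_ob f) (hf_ob g);
  hf_id : forall f : Hom X Y, hf_cell (id2 f) = id2 (hf_ob f);
  hf_vcomp : forall (f g h : Hom X Y) (b : Cell g h) (a : Cell f g),
    hf_cell (b ∘ a) = hf_cell b ∘ hf_cell a
}.

Notation "F ⟪ a ⟫" := (hf_cell F a) (at level 9, format "F ⟪ a ⟫") : bicat_scope.

Record pseudofunctor (D E : bicategory) := Pseudofunctor {
  pf_ob :> D -> E;
  pf_hom : forall X Y : D, hom_functor X Y (pf_ob X) (pf_ob Y);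
  pf_comp : forall (X Y Z : D) (g : Hom Y Z) (f : Hom X Y),
    Cell (pf_hom Y Z g · pf_hom X Y f) (pf_hom X Z (g · f));
  pf_unit : forall X : D, Cell (id1 (pf_ob X)) (pf_hom X X (id1 X));
  pf_comp_invertible : forall (X Y Z : D) (g : Hom Y Z) (f : Hom X Y),
    invertible (pf_comp g f);
  pf_unit_invertible : forall X : D, invertible (pf_unit X);
  pf_comp_natural : forall (X Y Z : D) (g g' : Hom Y Z) (f f' : Hom X Y)
      (b : Cell g g') (a : Cell f f'),
    pf_comp g' f' ∘ ((pf_hom Y Z)⟪b⟫ ⋆ (pf_hom X Y)⟪a⟫)
    = (pf_hom X Z)⟪b ⋆ a⟫ ∘ pf_comp g f;
  pf_assoc : forall (W X Y Z : D) (h : Hom Y Z) (g : Hom X Y) (f : Hom W X),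
    (pf_hom W Z)⟪assoc h g f⟫ ∘ pf_comp (h · g) f ∘ (pf_comp h g ▹ pf_hom W X f)
    = pf_comp h (g · f) ∘ (pf_hom Y Z h ◃ pf_comp g f)
      ∘ assoc (pf_hom Y Z h) (pf_hom X Y g) (pf_hom W X f);
  pf_lunit : forall (X Y : D) (f : Hom X Y),
    (pf_hom X Y)⟪lunit f⟫ ∘ pf_comp (id1 Y) f ∘ (pf_unit Y ▹ pf_hom X Y f)
    = lunit (pf_hom X Y f);
  pf_runit : forall (X Y : D) (f : Hom X Y),
    (pf_hom X Y)⟪runit f⟫ ∘ pf_comp f (id1 X) ∘ (pf_hom X Y f ◃ pf_unit X)
    = runit (pf_hom X Y f)
}.

(* The occurrences of [assoc], [assoc_inv] and [runit_inv] in the axioms below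
   are the structural isomorphisms that are usually left implicit. Only the
   action of J on objects is involved. *)
Record relative_pseudomonad (A E : bicategory) (J : pseudofunctor A E) :=
  RelativePseudomonad {
  pm_ob :> A -> E;
  ext : forall X Y : A, hom_functor (J X) (pm_ob Y) (pm_ob X) (pm_ob Y);
  pm_i : forall X : A, Hom (J X) (pm_ob X);
  mu : forall (X Y Z : A) (g : Hom (J Y) (pm_ob Z)) (f : Hom (J X) (pm_ob Y)),
    Cell (ext X Z (ext Y Z g · f)) (ext Y Z g · ext X Y f);
  eta : forall (X Y : A) (f : Hom (J X) (pm_ob Y)), Cell f (ext X Y f · pm_i X);
  theta : forall X : A, Cell (ext X X (pm_i X)) (id1 (pm_ob X));
  mu_invertible : forall (X Y Z : A) (g : Hom (J Y) (pm_ob Z))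
      (f : Hom (J X) (pm_ob Y)), invertible (mu g f);
  eta_invertible : forall (X Y : A) (f : Hom (J X) (pm_ob Y)),
    invertible (eta f);
  theta_invertible : forall X : A, invertible (theta X);
  mu_natural : forall (X Y Z : A) (g g' : Hom (J Y) (pm_ob Z))
      (f f' : Hom (J X) (pm_ob Y)) (b : Cell g g') (a : Cell f f'),
    mu g' f' ∘ (ext X Z)⟪(ext Y Z)⟪b⟫ ⋆ a⟫
    = ((ext Y Z)⟪b⟫ ⋆ (ext X Y)⟪a⟫) ∘ mu g f;
  eta_natural : forall (X Y : A) (f f' : Hom (J X) (pm_ob Y)) (a : Cell f f'),
    eta f' ∘ a = ((ext X Y)⟪a⟫ ▹ pm_i X) ∘ eta f;
  mu_assoc : forall (W X Y Z : A) (h : Hom (J Y) (pm_ob Z))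
      (g : Hom (J X) (pm_ob Y)) (f : Hom (J W) (pm_ob X)),
    (mu h g ▹ ext W X f) ∘ mu (ext Y Z h · g) f
    = assoc_inv (ext Y Z h) (ext X Y g) (ext W X f)
      ∘ (ext Y Z h ◃ mu g f)
      ∘ mu h (ext X Y g · f)
      ∘ (ext W Z)⟪assoc (ext Y Z h) (ext X Y g) f⟫
      ∘ (ext W Z)⟪mu h g ▹ f⟫;
  mu_unit : forall (X Y : A) (f : Hom (J X) (pm_ob Y)),
    (ext X Y f ◃ theta X) ∘ mu f (pm_i X) ∘ (ext X Y)⟪eta f⟫
    = runit_inv (ext X Y f)
}.

Arguments ext {A E J} r {X Y}.
Arguments pm_i {A E J} r X.
Arguments mu {A E J} r {X Y Z} g f.
Arguments eta {A E J} r {X Y} f.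
Arguments theta {A E J} r X.

Record pseudoalgebra (A E : bicategory) (J : pseudofunctor A E)
    (T : relative_pseudomonad J) := Pseudoalgebra {
  alg_ob :> E;
  alg_ext : forall X : A, hom_functor (J X) alg_ob (T X) alg_ob;
  alg_mu : forall (X Y : A) (g : Hom (J Y) alg_ob) (f : Hom (J X) (T Y)),
    Cell (alg_ext X (alg_ext Y g · f)) (alg_ext Y g · ext T f);
  alg_eta : forall (X : A) (f : Hom (J X) alg_ob),
    Cell f (alg_ext X f · pm_i T X);
  alg_mu_invertible : forall (X Y : A) (g : Hom (J Y) alg_ob)
      (f : Hom (J X) (T Y)), invertible (alg_mu g f);
  alg_eta_invertible : forall (X : A) (f : Hom (J X) alg_ob),
    invertible (alg_eta f);
  alg_mu_natural : forall (X Y : A) (g g' : Hom (J Y) alg_ob)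
      (f f' : Hom (J X) (T Y)) (b : Cell g g') (a : Cell f f'),
    alg_mu g' f' ∘ (alg_ext X)⟪(alg_ext Y)⟪b⟫ ⋆ a⟫
    = ((alg_ext Y)⟪b⟫ ⋆ (ext T)⟪a⟫) ∘ alg_mu g f;
  alg_eta_natural : forall (X : A) (f f' : Hom (J X) alg_ob) (a : Cell f f'),
    alg_eta f' ∘ a = ((alg_ext X)⟪a⟫ ▹ pm_i T X) ∘ alg_eta f;
  alg_mu_assoc : forall (X Y Z : A) (h : Hom (J Z) alg_ob)
      (g : Hom (J Y) (T Z)) (f : Hom (J X) (T Y)),
    (alg_mu h g ▹ ext T f) ∘ alg_mu (alg_ext Z h · g) f
    = assoc_inv (alg_ext Z h) (ext T g) (ext T f)
      ∘ (alg_ext Z h ◃ mu T g f)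
      ∘ alg_mu h (ext T g · f)
      ∘ (alg_ext X)⟪assoc (alg_ext Z h) (ext T g) f⟫
      ∘ (alg_ext X)⟪alg_mu h g ▹ f⟫;
  alg_mu_unit : forall (X : A) (f : Hom (J X) alg_ob),
    (alg_ext X f ◃ theta T X) ∘ alg_mu f (pm_i T X) ∘ (alg_ext X)⟪alg_eta f⟫
    = runit_inv (alg_ext X f)
}.

Arguments alg_ext {A E J T} p {X}.
Arguments alg_mu {A E J T} p {X Y} g f.
Arguments alg_eta {A E J T} p {X} f.

Record lax_data (A E : bicategory) (J : pseudofunctor A E)
    (T : relative_pseudomonad J) (M N : pseudoalgebra T) := LaxData {
  lax_1cell :> Hom (alg_ob M) (alg_ob N);
  lax_2cell : forall (X : A) (f : Hom (J X) M),
    Cell (alg_ext N (lax_1cell · f)) (lax_1cell · alg_ext M f)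
}.

Arguments lax_2cell {A E J T M N} l {X} f.

Record is_lax_morphism (A E : bicategory) (J : pseudofunctor A E)
    (T : relative_pseudomonad J) (M N : pseudoalgebra T) (h : lax_data M N)
    : Prop := IsLaxMorphism {
  lax_natural : forall (X : A) (f f' : Hom (J X) M) (a : Cell f f'),
    lax_2cell h f' ∘ (alg_ext N)⟪h ◃ a⟫
    = (h ◃ (alg_ext M)⟪a⟫) ∘ lax_2cell h f;
  lax_mu : forall (X Y : A) (g : Hom (J Y) M) (f : Hom (J X) (T Y)),
    assoc_inv h (alg_ext M g) (ext T f)
    ∘ (h ◃ alg_mu M g f)
    ∘ lax_2cell h (alg_ext M g · f)
    ∘ (alg_ext N)⟪assoc h (alg_ext M g) f⟫
    ∘ (alg_ext N)⟪lax_2cell h g ▹ f⟫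
    = (lax_2cell h g ▹ ext T f) ∘ alg_mu N (h · g) f;
  lax_eta : forall (X : A) (f : Hom (J X) M),
    (lax_2cell h f ▹ pm_i T X) ∘ alg_eta N (h · f)
    = assoc_inv h (alg_ext M f) (pm_i T X) ∘ (h ◃ alg_eta M f)
}.

Record lax_morphism (A E : bicategory) (J : pseudofunctor A E)
    (T : relative_pseudomonad J) (M N : pseudoalgebra T) := LaxMorphism {
  lax_carrier :> lax_data M N;
  lax_laws : is_lax_morphism lax_carrier
}.

Definition is_transformation (A E : bicategory) (J : pseudofunctor A E)
    (T : relative_pseudomonad J) (M N : pseudoalgebra T) (h h' : lax_data M N)
    (a : Cell (lax_1cell h) (lax_1cell h')) : Prop :=
  forall (X : A) (f : Hom (J X) M),
    lax_2cell h' f ∘ (alg_ext N)⟪a ▹ f⟫ = (a ▹ alg_ext M f) ∘ lax_2cell h f.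

Record transformation (A E : bicategory) (J : pseudofunctor A E)
    (T : relative_pseudomonad J) (M N : pseudoalgebra T) (h h' : lax_data M N)
    := Transformation {
  trans_cell :> Cell (lax_1cell h) (lax_1cell h');
  trans_law : is_transformation trans_cell
}.

Definition lax_id (A E : bicategory) (J : pseudofunctor A E)
    (T : relative_pseudomonad J) (M : pseudoalgebra T) : lax_data M M :=
  @LaxData A E J T M M (id1 (alg_ob M))
    (fun X f => lunit_inv (alg_ext M f) ∘ (alg_ext M)⟪lunit f⟫).

Definition lax_comp (A E : bicategory) (J : pseudofunctor A E)
    (T : relative_pseudomonad J) (M N P : pseudoalgebra T)
    (h' : lax_data N P) (h : lax_data M N) : lax_data M P :=
  @LaxData A E J T M P (h' · h)
    (fun X f =>
       assoc_inv h' h (alg_ext M f)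
       ∘ (h' ◃ lax_2cell h f)
       ∘ lax_2cell h' (h · f)
       ∘ (alg_ext P)⟪assoc h' h f⟫).

(* The operations on lax morphisms and transformations are inherited from E;
   they are well defined exactly when the following closure properties hold. *)
Record psalg_closed (A E : bicategory) (J : pseudofunctor A E)
    (T : relative_pseudomonad J) : Prop := PsAlgClosed {
  closed_id1 : forall M : pseudoalgebra T, is_lax_morphism (lax_id M);
  closed_comp : forall (M N P : pseudoalgebra T)
      (h' : lax_morphism N P) (h : lax_morphism M N),
    is_lax_morphism (lax_comp h' h);
  closed_id2 : forall (M N : pseudoalgebra T) (h : lax_morphism M N),
    @is_transformation A E J T M N h h (id2 (lax_1cell h));
  closed_vcomp : forall (M N : pseudoalgebra T) (h h' h'' : lax_morphism M N)
      (b : transformation h' h'') (a : transformation h h'),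
    @is_transformation A E J T M N h h'' (trans_cell b ∘ trans_cell a);
  closed_hcomp : forall (M N P : pseudoalgebra T) (k k' : lax_morphism N P)
      (h h' : lax_morphism M N) (b : transformation k k')
      (a : transformation h h'),
    @is_transformation A E J T M P (lax_comp k h) (lax_comp k' h')
      (trans_cell b ⋆ trans_cell a);
  closed_assoc : forall (M N P Q : pseudoalgebra T) (k : lax_morphism P Q)
      (h : lax_morphism N P) (g : lax_morphism M N),
    @is_transformation A E J T M Q
      (lax_comp (lax_comp k h) g) (lax_comp k (lax_comp h g)) (assoc k h g);
  closed_assoc_inv : forall (M N P Q : pseudoalgebra T) (k : lax_morphism P Q)
      (h : lax_morphism N P) (g : lax_morphism M N),
    @is_transformation A E J T M Q
      (lax_comp k (lax_comp h g)) (lax_comp (lax_comp k h) g) (assoc_inv k h g);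
  closed_lunit : forall (M N : pseudoalgebra T) (h : lax_morphism M N),
    @is_transformation A E J T M N (lax_comp (lax_id N) h) h (lunit h);
  closed_lunit_inv : forall (M N : pseudoalgebra T) (h : lax_morphism M N),
    @is_transformation A E J T M N h (lax_comp (lax_id N) h) (lunit_inv h);
  closed_runit : forall (M N : pseudoalgebra T) (h : lax_morphism M N),
    @is_transformation A E J T M N (lax_comp h (lax_id M)) h (runit h);
  closed_runit_inv : forall (M N : pseudoalgebra T) (h : lax_morphism M N),
    @is_transformation A E J T M N h (lax_comp h (lax_id M)) (runit_inv h)
}.

Definition PsAlg_l (A E : bicategory) (J : pseudofunctor A E)
    (T : relative_pseudomonad J) (c : psalg_closed T) : bicat_data := {|
  Ob := pseudoalgebra T;
  Hom := fun M N => lax_morphism M N;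
  Cell := fun M N h h' => transformation h h';
  id1 := fun M => LaxMorphism (closed_id1 c M);
  comp := fun M N P h' h => LaxMorphism (closed_comp c h' h);
  id2 := fun M N h => Transformation (closed_id2 c h);
  vcomp := fun M N h h' h'' b a => Transformation (closed_vcomp c b a);
  hcomp := fun M N P k k' h h' b a => Transformation (closed_hcomp c b a);
  assoc := fun M N P Q k h g => Transformation (closed_assoc c k h g);
  assoc_inv := fun M N P Q k h g => Transformation (closed_assoc_inv c k h g);
  lunit := fun M N h => Transformation (closed_lunit c h);
  lunit_inv := fun M N h => Transformation (closed_lunit_inv c h);
  runit := fun M N h => Transformation (closed_runit c h);
  runit_inv := fun M N h => Transformation (closed_runit_inv c h)
|}.

(* Main.v *)
Require Import Defs.
From Corelib Require Import ssreflect.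
From Stdlib Require Import ProofIrrelevance.

Set Implicit Arguments.
Unset Strict Implicit.
Unset Printing Implicit Defensive.

(** Two things need proof: that the operations of E restrict to lax morphisms
    and transformations, and that the restricted operations obey the bicategory
    axioms. The second is immediate once the first is known: a transformation
    is a 2-cell of E satisfying an equation, so two transformations with the
    same underlying 2-cell are equal ([transformation_ext]), and each axiom is
    the corresponding axiom of E.

    The content is therefore in the closure properties. For composites
    ([lax_comp_is_lax]) one pastes the compatibility squares of h' and of h: a
    square for h' is applied to the 1-cell h f, a square for h is whiskered by
    h', and naturality of the 2-cells of h' lets a 2-cell coming from h pass
    through an extension operation. What is left over consists of associators,
    which cancel by the pentagon in E and, for the multiplication law, once more
    inside the extension functor. For identities ([lax_id_is_lax]) the same role is played
    by naturality of the algebra structure along the left unitor, together with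
    the fact that the left unitor of g f is that of g whiskered by f, up to an
    associator ([lunit_comp]). The coherence cells are transformations by the
    pentagon (associator), by [lunit_comp] (left unitor) and by the triangle
    (right unitor); their inverses are transformations because the defining
    square of an invertible transformation can be turned around
    ([is_transformation_inverse]).

    Every equation is proved by writing both sides as right-nested vertical
    composites of whiskerings and replacing two or three consecutive factors
    at a time. *)

(** * Calculus of vertical composites *)

(** Laws of E with the bicategory left to unification. *)
Lemma vassoc (E : bicategory) (X Y : E) (f g h k : Hom X Y)
    (c : Cell h k) (b : Cell g h) (a : Cell f g) :
  (c ∘ b) ∘ a = c ∘ (b ∘ a).
Proof. exact (vcomp_assoc (bicat_laws E) c b a). Qed.

Lemma vid_l (E : bicategory) (X Y : E) (f g : Hom X Y) (a : Cell f g) :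
  id2 g ∘ a = a.
Proof. exact (vcomp_id_l (bicat_laws E) a). Qed.

Lemma vid_r (E : bicategory) (X Y : E) (f g : Hom X Y) (a : Cell f g) :
  a ∘ id2 f = a.
Proof. exact (vcomp_id_r (bicat_laws E) a). Qed.

(** The two tail lemmas apply an equation between short composites in the
    middle of a right-nested composite, where its left-hand side is not a
    subterm. *)
Lemma vcomp_tail2 (E : bicategory) (X Y : E) (f g h k : Hom X Y)
    (c : Cell h k) (b : Cell g h) (d : Cell g k) :
  c ∘ b = d -> forall a : Cell f g, c ∘ (b ∘ a) = d ∘ a.
Proof. by move=> <- a; rewrite vassoc. Qed.

Lemma vcomp_tail3 (E : bicategory) (X Y : E) (e f g h k : Hom X Y)
    (c : Cell h k) (b : Cell g h) (a : Cell f g) (d : Cell f k) :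
  c ∘ (b ∘ a) = d -> forall z : Cell e f, c ∘ (b ∘ (a ∘ z)) = d ∘ z.
Proof. by move=> <- z; rewrite !vassoc. Qed.

Lemma whisker_l_vcomp (E : bicategory) (X Y Z : E) (h : Hom Y Z)
    (f f' f'' : Hom X Y) (b : Cell f' f'') (a : Cell f f') :
  h ◃ (b ∘ a) = (h ◃ b) ∘ (h ◃ a).
Proof. by rewrite -(hcomp_vcomp (bicat_laws E)) vid_l. Qed.

Lemma whisker_r_vcomp (E : bicategory) (X Y Z : E) (f : Hom X Y)
    (h h' h'' : Hom Y Z) (b : Cell h' h'') (a : Cell h h') :
  (b ∘ a) ▹ f = (b ▹ f) ∘ (a ▹ f).
Proof. by rewrite -(hcomp_vcomp (bicat_laws E)) vid_l. Qed.

Lemma hcomp_whiskers (E : bicategory) (X Y Z : E) (g g' : Hom Y Z)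
    (f f' : Hom X Y) (b : Cell g g') (a : Cell f f') :
  b ⋆ a = (g' ◃ a) ∘ (b ▹ f).
Proof. by rewrite -(hcomp_vcomp (bicat_laws E)) vid_l vid_r. Qed.

Lemma whisker_exchange (E : bicategory) (X Y Z : E) (g g' : Hom Y Z)
    (f f' : Hom X Y) (b : Cell g g') (a : Cell f f') :
  (b ▹ f') ∘ (g ◃ a) = (g' ◃ a) ∘ (b ▹ f).
Proof. by rewrite -!(hcomp_vcomp (bicat_laws E)) !vid_l !vid_r. Qed.

Lemma vcomp_epi (E : bicategory) (X Y : E) (f g h : Hom X Y)
    (i : Cell f g) (j : Cell g f) (a b : Cell g h) :
  i ∘ j = id2 g -> a ∘ i = b ∘ i -> a = b.
Proof. by move=> ij ai; rewrite -(vid_r a) -(vid_r b) -ij -!vassoc ai. Qed.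

(** Turns a commuting square with two parallel invertible sides around, so that
    naturality of a family of isomorphisms passes to the inverses. *)
Lemma inverse_square (E : bicategory) (X Y : E) (p q r s : Hom X Y)
    (i : Cell p q) (i' : Cell q p) (j : Cell r s) (j' : Cell s r)
    (u : Cell p r) (v : Cell q s) :
  i ∘ i' = id2 q -> j' ∘ j = id2 r -> j ∘ u = v ∘ i -> j' ∘ v = u ∘ i'.
Proof.
move=> ii jj sq.
by rewrite -(vid_r v) -ii -(vassoc v) -sq vassoc -!(vassoc j') jj vid_l.
Qed.

(* Whiskerings and extensions are distributed over vertical composites. They
   nest in each other, hence the repetition of the rules. *)
Ltac norm :=
  rewrite ?whisker_l_vcomp ?whisker_r_vcomp ?hf_vcomp ?whisker_l_vcomp
    ?whisker_r_vcomp ?hf_vcomp ?vassoc.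

(* Rewriting by H modulo associativity, for a left-hand side of at most three
   factors. *)
Ltac step H :=
  let K := fresh in
  pose proof H as K; rewrite ?vassoc in K;
  first [rewrite (vcomp_tail3 K) | rewrite (vcomp_tail2 K) | rewrite K];
  clear K; rewrite ?vassoc.

(** * Coherence in a bicategory *)

Lemma assoc_inv_natural (E : bicategory) (W X Y Z : E) (h h' : Hom Y Z)
    (g g' : Hom X Y) (f f' : Hom W X) (c : Cell h h') (b : Cell g g')
    (a : Cell f f') :
  assoc_inv h' g' f' ∘ (c ⋆ (b ⋆ a)) = ((c ⋆ b) ⋆ a) ∘ assoc_inv h g f.
Proof.
exact (inverse_square
  (assoc_inv_r (bicat_laws E) h g f) (assoc_inv_l (bicat_laws E) h' g' f')
  (assoc_natural (bicat_laws E) c b a)).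
Qed.

Lemma assoc_whisker_l (E : bicategory) (W X Y Z : E) (h : Hom Y Z)
    (g : Hom X Y) (f f' : Hom W X) (a : Cell f f') :
  assoc h g f' ∘ ((h · g) ◃ a) = (h ◃ (g ◃ a)) ∘ assoc h g f.
Proof. by rewrite -(hcomp_id (bicat_laws E)) (assoc_natural (bicat_laws E)). Qed.

Lemma assoc_inv_whisker_l (E : bicategory) (W X Y Z : E) (h : Hom Y Z)
    (g : Hom X Y) (f f' : Hom W X) (a : Cell f f') :
  assoc_inv h g f' ∘ (h ◃ (g ◃ a)) = ((h · g) ◃ a) ∘ assoc_inv h g f.
Proof. by rewrite -(hcomp_id (bicat_laws E)) assoc_inv_natural. Qed.

Lemma assoc_inv_whisker_m (E : bicategory) (W X Y Z : E) (h : Hom Y Z)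
    (g g' : Hom X Y) (f : Hom W X) (b : Cell g g') :
  assoc_inv h g' f ∘ (h ◃ (b ▹ f)) = ((h ◃ b) ▹ f) ∘ assoc_inv h g f.
Proof. exact (assoc_inv_natural (id2 h) b (id2 f)). Qed.

Lemma assoc_whisker_r (E : bicategory) (W X Y Z : E) (h h' : Hom Y Z)
    (g : Hom X Y) (f : Hom W X) (c : Cell h h') :
  assoc h' g f ∘ ((c ▹ g) ▹ f) = (c ▹ (g · f)) ∘ assoc h g f.
Proof. by rewrite -(hcomp_id (bicat_laws E)) (assoc_natural (bicat_laws E)). Qed.

(** Kelly's argument: whiskering with an identity 1-cell is faithful by
    naturality of the unitor, and after whiskering the equation follows from
    the pentagon for 1, 1, g, f and the two instances of the triangle that it
    contains. *)
Lemma lunit_comp (E : bicategory) (X Y Z : E) (g : Hom Y Z) (f : Hom X Y) :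
  lunit (g · f) ∘ assoc (id1 Z) g f = lunit g ▹ f.
Proof.
have faithful : forall (p q : Hom X Z) (a b : Cell p q),
    id1 Z ◃ a = id1 Z ◃ b -> a = b.
  move=> p q a b ab.
  apply: (vcomp_epi (lunit_inv_r (bicat_laws E) p)).
  by rewrite -!(lunit_natural (bicat_laws E)) ab.
apply: faithful.
apply: (vcomp_epi (assoc_inv_r (bicat_laws E) (id1 Z) (id1 Z · g) f)).
have iso : (assoc (id1 Z) (id1 Z) g ▹ f) ∘ (assoc_inv (id1 Z) (id1 Z) g ▹ f)
    = id2 _.
  by rewrite -whisker_r_vcomp (assoc_inv_r (bicat_laws E))
      (hcomp_id (bicat_laws E)).
apply: (vcomp_epi iso).
norm.
rewrite -(vassoc (_ ◃ assoc _ _ _)) -(pentagon (bicat_laws E)).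
step (triangle (bicat_laws E) (id1 Z) (g · f)).
rewrite -assoc_whisker_r -(triangle (bicat_laws E)).
norm.
by step (assoc_natural (bicat_laws E) (id2 (id1 Z)) (lunit g) (id2 f)).
Qed.

Lemma lunit_inv_natural (E : bicategory) (X Y : E) (f f' : Hom X Y)
    (a : Cell f f') :
  lunit_inv f' ∘ a = (id1 Y ◃ a) ∘ lunit_inv f.
Proof.
exact (inverse_square (lunit_inv_r (bicat_laws E) f)
  (lunit_inv_l (bicat_laws E) f') (lunit_natural (bicat_laws E) a)).
Qed.

Lemma lunit_inv_comp (E : bicategory) (X Y Z : E) (g : Hom Y Z) (f : Hom X Y) :
  assoc_inv (id1 Z) g f ∘ lunit_inv (g · f) = lunit_inv g ▹ f.
Proof.
have iso : (lunit g ▹ f) ∘ (lunit_inv g ▹ f) = id2 (g · f).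
  by rewrite -whisker_r_vcomp (lunit_inv_r (bicat_laws E))
      (hcomp_id (bicat_laws E)).
have iso' : (assoc_inv (id1 Z) g f ∘ lunit_inv (g · f)) ∘
    (lunit (g · f) ∘ assoc (id1 Z) g f) = id2 _.
  rewrite vassoc (vcomp_tail2 (lunit_inv_l (bicat_laws E) _)) vid_l.
  exact (assoc_inv_l (bicat_laws E) _ _ _).
rewrite -[LHS]vid_r -iso -lunit_comp.
by rewrite -(vassoc (_ ∘ _) (_ ∘ _)) iso' vid_l.
Qed.

(** This and the next two lemmas are the forms in which the pentagon occurs in
    the closure proofs, where associators and their inverses are mixed. *)
Lemma pentagon_inv (E : bicategory) (V W X Y Z : E) (k : Hom Y Z) (h : Hom X Y)
    (g : Hom W X) (f : Hom V W) :
  (assoc_inv k h g ▹ f) ∘ assoc_inv k (h · g) f ∘ (k ◃ assoc_inv h g f)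
  = assoc_inv (k · h) g f ∘ assoc_inv k h (g · f).
Proof.
have iso : (assoc k h (g · f) ∘ assoc (k · h) g f) ∘
   (assoc_inv (k · h) g f ∘ assoc_inv k h (g · f)) = id2 _.
  rewrite vassoc (vcomp_tail2 (assoc_inv_r (bicat_laws E) _ _ _)).
  by rewrite vid_l (assoc_inv_r (bicat_laws E)).
apply: (vcomp_epi iso).
rewrite {1}(pentagon (bicat_laws E)); norm.
step (eq_sym (whisker_l_vcomp k (assoc_inv h g f) (assoc h g f))).
rewrite (assoc_inv_l (bicat_laws E)) (hcomp_id (bicat_laws E)) vid_l.
step (assoc_inv_l (bicat_laws E) k (h · g) f).
rewrite vid_l -whisker_r_vcomp.
step (assoc_inv_l (bicat_laws E) k h (g · f)).
by rewrite vid_l !(assoc_inv_l (bicat_laws E)) (hcomp_id (bicat_laws E)).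
Qed.

Lemma pentagon_inv_rot (E : bicategory) (V W X Y Z : E) (k : Hom Y Z)
    (h : Hom X Y) (g : Hom W X) (f : Hom V W) :
  (assoc k h g ▹ f) ∘ (assoc_inv (k · h) g f ∘ assoc_inv k h (g · f))
  = assoc_inv k (h · g) f ∘ (k ◃ assoc_inv h g f).
Proof.
rewrite -pentagon_inv vassoc -vassoc -whisker_r_vcomp (assoc_inv_r (bicat_laws E)).
by rewrite (hcomp_id (bicat_laws E)) vid_l.
Qed.

Lemma pentagon_rot (E : bicategory) (V W X Y Z : E) (k : Hom Y Z) (h : Hom X Y)
    (g : Hom W X) (f : Hom V W) :
  assoc k h (g · f) ∘ (assoc (k · h) g f ∘ (assoc_inv k h g ▹ f))
  = (k ◃ assoc h g f) ∘ assoc k (h · g) f.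
Proof.
step (pentagon (bicat_laws E) k h g f).
by rewrite -whisker_r_vcomp (assoc_inv_r (bicat_laws E))
  (hcomp_id (bicat_laws E)) vid_r.
Qed.

(** * Lax morphisms *)

(** The structure cell is the left unitor, once extended and once inverted. The
    laws for the multiplication and the unit of M are their naturality along
    the left unitor, the remaining unitors cancelling by [lunit_comp]. *)
Lemma lax_id_is_lax (A E : bicategory) (J : pseudofunctor A E)
    (T : relative_pseudomonad J) (M : pseudoalgebra T) :
  is_lax_morphism (lax_id M).
Proof.
split=> /=.
- move=> X f f' a; norm.
  rewrite -hf_vcomp (lunit_natural (bicat_laws E)) hf_vcomp.
  by step (lunit_inv_natural ((alg_ext M)⟪a⟫)).
- move=> X Y g f; norm.
  step (eq_sym (lunit_inv_natural (alg_mu M g f))).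
  step (eq_sym (hf_vcomp (alg_ext M) (lunit (alg_ext M g · f))
    (assoc (id1 _) (alg_ext M g) f))).
  rewrite lunit_comp.
  step (eq_sym (hf_vcomp (alg_ext M) (lunit (alg_ext M g) ▹ f)
    (lunit_inv (alg_ext M g) ▹ f))).
  rewrite -whisker_r_vcomp (lunit_inv_r (bicat_laws E)) (hcomp_id (bicat_laws E)).
  rewrite hf_id vid_l.
  rewrite (alg_mu_natural (lunit g) (id2 f)) hf_id.
  by step (lunit_inv_comp (alg_ext M g) (ext T f)).
- move=> X f; norm.
  rewrite -(alg_eta_natural (lunit f)).
  step (eq_sym (lunit_inv_comp (alg_ext M f) (pm_i T X))).
  step (lunit_inv_natural (alg_eta M f)).
  by rewrite (lunit_inv_l (bicat_laws E)) vid_r.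
Qed.

(** Each law of h'h is the law of h', taken at a 1-cell composed with h, pasted
    with the law of h whiskered by h'. *)
Lemma lax_comp_is_lax (A E : bicategory) (J : pseudofunctor A E)
    (T : relative_pseudomonad J) (M N P : pseudoalgebra T)
    (h' : lax_morphism N P) (h : lax_morphism M N) :
  is_lax_morphism (lax_comp h' h).
Proof.
split=> /=.
- move=> X f f' a; norm.
  rewrite -hf_vcomp assoc_whisker_l hf_vcomp.
  step (lax_natural (lax_laws h') (h ◃ a)).
  step (eq_sym (whisker_l_vcomp h' (lax_2cell h f') ((alg_ext N)⟪h ◃ a⟫))).
  rewrite (lax_natural (lax_laws h) a) whisker_l_vcomp vassoc.
  by step (assoc_inv_whisker_l h' h ((alg_ext M)⟪a⟫)).
- move=> X Y g f; norm.
  (* Naturality of the multiplication is stated for the extension of a 2-cell,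
     so the identity on the extension of f has to be seen as one. *)
  rewrite -(hf_id (ext T) f).
  step (eq_sym (alg_mu_natural (assoc h' h g) (id2 f))).
  rewrite hf_id.
  step (eq_sym (lax_mu (lax_laws h') (h · g) f)).
  step (eq_sym (assoc_inv_whisker_m h' (ext T f) (lax_2cell h g))).
  step (eq_sym (whisker_l_vcomp h' (lax_2cell h g ▹ ext T f)
    (alg_mu N (h · g) f))).
  rewrite -(lax_mu (lax_laws h) g f); norm.
  (* The cells of h that sit inside the extension of N pass across the cell
     of h' and end up inside the extension of P. *)
  step (eq_sym (lax_natural (lax_laws h') (lax_2cell h g ▹ f))).
  step (eq_sym (lax_natural (lax_laws h') (assoc h (alg_ext M g) f))).
  step (pentagon_inv h' h (alg_ext M g) (ext T f)).
  step (assoc_inv_whisker_l h' h (alg_mu M g f)).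
  (* The two sides now differ only inside the extension of P. The associators
     there are collected into one composite to which the pentagon applies. *)
  step (eq_sym (hf_vcomp (alg_ext P) (assoc (h' · h) (alg_ext M g) f)
    (assoc_inv h' h (alg_ext M g) ▹ f))).
  step (eq_sym (hf_vcomp (alg_ext P) (assoc h' h (alg_ext M g · f))
    (assoc (h' · h) (alg_ext M g) f ∘ (assoc_inv h' h (alg_ext M g) ▹ f)))).
  rewrite pentagon_rot hf_vcomp vassoc.
  step (eq_sym (hf_vcomp (alg_ext P) (assoc h' (h · alg_ext M g) f)
    ((h' ◃ lax_2cell h g) ▹ f))).
  rewrite (assoc_natural (bicat_laws E) (id2 (lax_1cell h')) (lax_2cell h g)
    (id2 f)).
  by rewrite hf_vcomp vassoc.
- move=> X f; norm.
  rewrite -(alg_eta_natural (assoc h' h f)).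
  step (lax_eta (lax_laws h') (h · f)).
  step (eq_sym (assoc_inv_whisker_m h' (pm_i T X) (lax_2cell h f))).
  step (eq_sym (whisker_l_vcomp h' (lax_2cell h f ▹ pm_i T X)
    (alg_eta N (h · f)))).
  rewrite (lax_eta (lax_laws h) f); norm.
  step (pentagon_inv h' h (alg_ext M f) (pm_i T X)).
  step (assoc_inv_whisker_l h' h (alg_eta M f)).
  by rewrite (assoc_inv_l (bicat_laws E)) vid_r.
Qed.

(** * Transformations *)

Lemma is_transformation_inverse (A E : bicategory) (J : pseudofunctor A E)
    (T : relative_pseudomonad J) (M N : pseudoalgebra T) (h h' : lax_data M N)
    (a : Cell (lax_1cell h) (lax_1cell h'))
    (b : Cell (lax_1cell h') (lax_1cell h)) :
  b ∘ a = id2 _ -> a ∘ b = id2 _ -> is_transformation a -> is_transformation b.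
Proof.
move=> ba ab a_trans X f.
have ext_iso : (alg_ext N)⟪a ▹ f⟫ ∘ (alg_ext N)⟪b ▹ f⟫ = id2 _.
  by rewrite -hf_vcomp -whisker_r_vcomp ab (hcomp_id (bicat_laws E)) hf_id.
have post_iso : (b ▹ alg_ext M f) ∘ (a ▹ alg_ext M f) = id2 _.
  by rewrite -whisker_r_vcomp ba (hcomp_id (bicat_laws E)).
symmetry; exact (inverse_square ext_iso post_iso (eq_sym (a_trans X f))).
Qed.

Lemma transformation_ext (A E : bicategory) (J : pseudofunctor A E)
    (T : relative_pseudomonad J) (M N : pseudoalgebra T) (h h' : lax_data M N)
    (a b : transformation h h') :
  trans_cell a = trans_cell b -> a = b.
Proof.
case: a b => [a a_trans] [b b_trans] /= ab; case: b / ab b_trans => b_trans.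
by rewrite (proof_irrelevance _ a_trans b_trans).
Qed.

Lemma is_transformation_id2 (A E : bicategory) (J : pseudofunctor A E)
    (T : relative_pseudomonad J) (M N : pseudoalgebra T)
    (h : lax_data M N) :
  is_transformation (h := h) (h' := h) (id2 (lax_1cell h)).
Proof.
by move=> X f; rewrite !(hcomp_id (bicat_laws E)) hf_id vid_l vid_r.
Qed.

Lemma is_transformation_vcomp (A E : bicategory) (J : pseudofunctor A E)
    (T : relative_pseudomonad J) (M N : pseudoalgebra T)
    (h h' h'' : lax_data M N)
    (b : transformation h' h'') (a : transformation h h') :
  is_transformation (h := h) (h' := h'') (trans_cell b ∘ trans_cell a).
Proof.
move=> X f; norm.
step (trans_law b f).
by rewrite (trans_law a f).
Qed.

(** The horizontal composite is split as b followed by a, each whiskered. The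
    square of a is applied after naturality of the cells of k', the square of b
    is taken at h f, and interchange moves b past the cell of h. *)
Lemma is_transformation_hcomp (A E : bicategory) (J : pseudofunctor A E)
    (T : relative_pseudomonad J) (M N P : pseudoalgebra T)
    (k k' : lax_morphism N P) (h h' : lax_morphism M N)
    (b : transformation k k') (a : transformation h h') :
  @is_transformation A E J T M P (lax_comp k h) (lax_comp k' h')
    (trans_cell b ⋆ trans_cell a).
Proof.
move=> X f /=; norm.
rewrite -hf_vcomp (assoc_natural (bicat_laws E) b a (id2 f)) hf_vcomp.
rewrite (hcomp_whiskers b (a ▹ f)) hf_vcomp vassoc.
step (lax_natural (lax_laws k') (trans_cell a ▹ f)).
step (trans_law b (h · f)).
step (eq_sym (whisker_l_vcomp k' (lax_2cell h' f) ((alg_ext N)⟪a ▹ f⟫))).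
rewrite (trans_law a f); norm.
step (eq_sym (whisker_exchange b (lax_2cell h f))).
step (eq_sym (hcomp_whiskers b (trans_cell a ▹ alg_ext M f))).
by step (assoc_inv_natural b a (id2 (alg_ext M f))).
Qed.

(** After the cell of k is moved past the associator for h, g, f, the two sides
    differ by one pentagon inside the extension functor and one reversed
    pentagon outside. *)
Lemma is_transformation_assoc (A E : bicategory) (J : pseudofunctor A E)
    (T : relative_pseudomonad J) (M N P Q : pseudoalgebra T)
    (k : lax_morphism P Q) (h : lax_morphism N P) (g : lax_morphism M N) :
  @is_transformation A E J T M Q
    (lax_comp (lax_comp k h) g) (lax_comp k (lax_comp h g)) (assoc k h g).
Proof.
move=> X f /=; norm.
step (eq_sym (lax_natural (lax_laws k) (assoc h g f))).
rewrite -[X in _ = _ ∘ (_ ∘ (_ ∘ (_ ∘ (_ ∘ (_ ∘ X)))))]hf_vcomp.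
rewrite (pentagon (bicat_laws E)).
rewrite !hf_vcomp vassoc.
step (eq_sym (assoc_inv_whisker_l k h (lax_2cell g f))).
by step (pentagon_inv_rot k h g (alg_ext M f)).
Qed.

Lemma is_transformation_lunit (A E : bicategory) (J : pseudofunctor A E)
    (T : relative_pseudomonad J) (M N : pseudoalgebra T)
    (h : lax_morphism M N) :
  @is_transformation A E J T M N (lax_comp (lax_id N) h) h (lunit h).
Proof.
move=> X f /=; norm.
rewrite -hf_vcomp lunit_comp.
step (eq_sym (lunit_inv_natural (lax_2cell h f))).
step (lunit_inv_comp h (alg_ext M f)).
step (eq_sym (whisker_r_vcomp (alg_ext M f) (lunit h) (lunit_inv h))).
by rewrite (lunit_inv_r (bicat_laws E)) (hcomp_id (bicat_laws E)) vid_l.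
Qed.

Lemma is_transformation_runit (A E : bicategory) (J : pseudofunctor A E)
    (T : relative_pseudomonad J) (M N : pseudoalgebra T)
    (h : lax_morphism M N) :
  @is_transformation A E J T M N (lax_comp h (lax_id M)) h (runit h).
Proof.
move=> X f /=; norm.
rewrite -!(triangle (bicat_laws E)) hf_vcomp.
step (lax_natural (lax_laws h) (lunit f)).
step (assoc_inv_r (bicat_laws E) h (id1 M) (alg_ext M f)).
rewrite vid_l.
step (eq_sym (whisker_l_vcomp h (lunit (alg_ext M f)) (lunit_inv (alg_ext M f)))).
by rewrite (lunit_inv_r (bicat_laws E)) (hcomp_id (bicat_laws E)) vid_l.
Qed.

(** * The bicategory *)

Lemma psalg_closure (A E : bicategory) (J : pseudofunctor A E)
    (T : relative_pseudomonad J) : psalg_closed T.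
Proof.
split.
- exact (@lax_id_is_lax A E J T).
- exact (@lax_comp_is_lax A E J T).
- by move=> M N h; apply: is_transformation_id2.
- by move=> M N h h' h'' b a; apply: is_transformation_vcomp.
- by move=> M N P k k' h h' b a; apply: is_transformation_hcomp.
- by move=> M N P Q k h g; apply: is_transformation_assoc.
- move=> M N P Q k h g.
  apply: is_transformation_inverse (is_transformation_assoc k h g).
  + exact (assoc_inv_l (bicat_laws E) _ _ _).
  + exact (assoc_inv_r (bicat_laws E) _ _ _).
- by move=> M N h; apply: is_transformation_lunit.
- move=> M N h; apply: is_transformation_inverse (is_transformation_lunit h).
  + exact (lunit_inv_l (bicat_laws E) _).
  + exact (lunit_inv_r (bicat_laws E) _).
- by move=> M N h; apply: is_transformation_runit.
- move=> M N h; apply: is_transformation_inverse (is_transformation_runit h).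
  + exact (runit_inv_l (bicat_laws E) _).
  + exact (runit_inv_r (bicat_laws E) _).
Qed.

Theorem theorem3p9 (A E : bicategory) (J : pseudofunctor A E)
    (T : relative_pseudomonad J) :
  exists c : psalg_closed T, is_bicategory (PsAlg_l c).
Proof.
exists (psalg_closure T).
have L := bicat_laws E.
split=> * /=; apply: transformation_ext; simpl.
all: apply L.
Qed.
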